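(* For every realization of the mask $U\in\{0,1\}^{n\times m}$ and every $q\in\mathbb{S}^{n-1}$, $$\|A^{\diamond}_{qq}\|_2\ \le\ \|A_0\|_2\,\|B_0\|_2,$$ where $$A^{\diamond}_{qq}=\sum_{k=1}^m\sum_{i\ne j}u^k_iu^k_j\,q_iq_j\,(c_jc_i^T)\otimes(d_kd_k^T)\in\mathbb{R}^{mn\times mn}.$$
   Context: $A_0\in\mathbb{R}^{m\times m}$ and $B_0\in\mathbb{R}^{n\times n}$ are symmetric positive definite (the paper normalizes $\mathrm{tr}(B_0)=n$). $A_0^{1/2}=[d_1,\dots,d_m]$ and $B_0^{1/2}=[c_1,\dots,c_n]$ are the unique symmetric positive definite square roots, written by columns $d_k\in\mathbb{R}^m$, $c_i\in\mathbb{R}^n$. $U=[u^1|\cdots|u^m]\in\{0,1\}^{n\times m}$ is the mask with columns $u^k=(u^k_1,\dots,u^k_n)^T$. $\otimes$ is the Kronecker (tensor) product, $\|\cdot\|_2$ the operator norm, $\mathbb{S}^{n-1}$ the unit sphere of $\mathbb{R}^n$, and $\sum_{i\ne j}$ is over ordered pairs of distinct indices in $\{1,\dots,n\}$. *)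

(* Defs.v *)
From mathcomp Require Import all_boot all_order all_algebra.
From mathcomp Require Import all_classical all_reals.
From mathcomp Require Import mxtens.
Set Implicit Arguments.
Unset Strict Implicit.
Unset Printing Implicit Defensive.
Import Order.TTheory GRing.Theory Num.Theory.
Local Open Scope classical_set_scope.
Local Open Scope ring_scope.

Definition euclid_norm (R : realType) (n : nat) (x : 'cV[R]_n) : R :=
  Num.sqrt (\sum_(i < n) x i 0 ^+ 2).

(* The supremum is taken over the closed unit ball rather than the sphere, so
   that the set is never empty, even for matrices with no column; it is bounded
   above by finite dimensionality, so sup does not take its default value. *)
Definition op_norm (R : realType) (p n : nat) (M : 'M[R]_(p, n)) : R :=
  sup [set euclid_norm (M *m x) | x in [set x : 'cV[R]_n | euclid_norm x <= 1]].

Definition sym_posdef (R : realType) (n : nat) (M : 'M[R]_n) : Prop :=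
  M^T = M /\ forall x : 'cV[R]_n, x != 0 -> 0 < (x^T *m M *m x) 0 0.

Definition is_posdef_sqrt (R : realType) (n : nat) (S M : 'M[R]_n) : Prop :=
  sym_posdef S /\ S *m S = M.

(* In use, SA and SB are the square roots of A0 and B0, so that col k SA is
   d_k and col i SB is c_i. The mask is boolean, and U i k : bool is read as
   the real number 0 or 1 through (U i k)%:R. The tensor product *t of mxtens
   is the Kronecker product. *)
Definition A_diamond (R : realType) (m n : nat) (SA : 'M[R]_m) (SB : 'M[R]_n)
    (U : 'M[bool]_(n, m)) (q : 'cV[R]_n) : 'M[R]_(n * m, n * m) :=
  \sum_(k < m) \sum_(i < n) \sum_(j < n | i != j)
    ((U i k)%:R * (U j k)%:R * (q i 0 * q j 0)) *:
      ((col j SB *m (col i SB)^T) *t (col k SA *m (col k SA)^T)).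

(* Main.v *)
(* The matrix is symmetric, so its norm is controlled by its quadratic form.
   With X the reshaping of x into an n x m matrix, Z = B0^(1/2) X A0^(1/2) and
   v_k the entrywise product of u^k and q, the form at x is the sum over k of
   the off-diagonal part of v_k v_k^T evaluated at the k-th column of Z. Since
   |v_k| <= |q| = 1, this is at most the squared Frobenius norm of Z, which is
   at most |A0| |B0| |X|_F^2. *)
Require Import Defs.
From mathcomp Require Import all_boot all_order all_algebra.
From mathcomp Require Import all_classical all_reals.
From mathcomp Require Import mxtens ring lra.
Set Implicit Arguments.
Unset Strict Implicit.
Unset Printing Implicit Defensive.
Import Order.TTheory GRing.Theory Num.Theory.
Local Open Scope ring_scope.

Definition dot (R : pzRingType) (n : nat) (u v : 'cV[R]_n) : R :=
  (u^T *m v) 0 0.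

Lemma dotE (R : pzRingType) n (u v : 'cV[R]_n) :
  dot u v = \sum_i u i 0 * v i 0.
Proof. by rewrite /dot mxE; apply: eq_bigr => i _; rewrite mxE. Qed.

Lemma dotC (R : comPzRingType) n (u v : 'cV[R]_n) : dot u v = dot v u.
Proof. by rewrite !dotE; apply: eq_bigr => i _; rewrite mulrC. Qed.

Lemma dotDl (R : pzRingType) n (u v w : 'cV[R]_n) :
  dot (u + v) w = dot u w + dot v w.
Proof. by rewrite /dot linearD mulmxDl mxE. Qed.

Lemma dotDr (R : pzRingType) n (u v w : 'cV[R]_n) :
  dot w (u + v) = dot w u + dot w v.
Proof. by rewrite /dot mulmxDr mxE. Qed.

Lemma dotZl (R : comPzRingType) n a (u v : 'cV[R]_n) :
  dot (a *: u) v = a * dot u v.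
Proof. by rewrite /dot linearZ -scalemxAl mxE. Qed.

Lemma dotZr (R : comPzRingType) n a (u v : 'cV[R]_n) :
  dot u (a *: v) = a * dot u v.
Proof. by rewrite dotC dotZl dotC. Qed.

Lemma dot_mulmx (R : comPzRingType) p n (M : 'M[R]_(p, n)) u v :
  dot u (M *m v) = dot (M^T *m u) v.
Proof. by rewrite /dot trmx_mul trmxK mulmxA. Qed.

Lemma dot_ge0 (R : realDomainType) n (u : 'cV[R]_n) : 0 <= dot u u.
Proof. by rewrite dotE sumr_ge0 // => i _; rewrite -expr2 sqr_ge0. Qed.

(** Lagrange's identity: the squares of all the minors [u_i v_j - u_j v_i] sum to twice the gap
    between the two sides. *)
Lemma dot_cauchy (R : realDomainType) n (u v : 'cV[R]_n) :
  dot u v ^+ 2 <= dot u u * dot v v.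
Proof.
have H : 0 <= \sum_i \sum_j (u i 0 * v j 0 - u j 0 * v i 0) ^+ 2.
  by apply: sumr_ge0 => i _; apply: sumr_ge0 => j _; apply: sqr_ge0.
have E : \sum_i \sum_j (u i 0 * v j 0 - u j 0 * v i 0) ^+ 2 =
    2 * (dot u u * dot v v - dot u v ^+ 2).
  rewrite expr2 !dotE [2 * _](_ : _ =
    (\sum_i u i 0 * u i 0) * (\sum_i v i 0 * v i 0) +
    (\sum_i v i 0 * v i 0) * (\sum_i u i 0 * u i 0) -
    2 * ((\sum_i u i 0 * v i 0) * (\sum_i u i 0 * v i 0))); last by ring.
  rewrite !big_distrlr mulr_sumr -big_split -sumrB /=; apply: eq_bigr => i _.
  rewrite mulr_sumr -big_split -sumrB /=; apply: eq_bigr => j _; ring.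
by move: H; rewrite E pmulr_rge0 ?ltr0n // subr_ge0.
Qed.

Lemma euclid_norm_ge0 (R : realType) n (u : 'cV[R]_n) : 0 <= euclid_norm u.
Proof. exact: sqrtr_ge0. Qed.

Lemma sqr_euclid_norm (R : realType) n (u : 'cV[R]_n) :
  euclid_norm u ^+ 2 = dot u u.
Proof.
rewrite /euclid_norm sqr_sqrtr ?sumr_ge0 // => [|i _]; last exact: sqr_ge0.
by rewrite dotE; apply: eq_bigr => i _; rewrite expr2.
Qed.

Lemma euclid_norm_dot (R : realType) n (u : 'cV[R]_n) :
  euclid_norm u = Num.sqrt (dot u u).
Proof. by rewrite -sqr_euclid_norm sqrtr_sqr ger0_norm ?euclid_norm_ge0. Qed.

Lemma euclid_normZ (R : realType) n a (u : 'cV[R]_n) :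
  euclid_norm (a *: u) = `|a| * euclid_norm u.
Proof.
rewrite !euclid_norm_dot dotZl dotZr mulrA -expr2.
by rewrite sqrtrM ?sqr_ge0 // sqrtr_sqr.
Qed.

Lemma euclid_norm0 (R : realType) n : euclid_norm (0 : 'cV[R]_n) = 0.
Proof. by have := euclid_normZ 0 (0 : 'cV[R]_n); rewrite scale0r normr0 mul0r. Qed.

Lemma euclid_norm_eq0 (R : realType) n (u : 'cV[R]_n) :
  euclid_norm u = 0 -> u = 0.
Proof.
move=> u0; have /esym/eqP : dot u u = 0 by rewrite -sqr_euclid_norm u0 expr0n.
rewrite dotE eq_sym psumr_eq0 => [/allP H|i _]; last by rewrite -expr2 sqr_ge0.
apply/colP => i; apply/eqP; rewrite mxE.
by have := H i (mem_index_enum i); rewrite -expr2 sqrf_eq0.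
Qed.

Local Open Scope classical_set_scope.

Lemma op_norm_has_ubound (R : realType) p n (M : 'M[R]_(p, n)) :
  has_ubound [set euclid_norm (M *m x) |
    x in [set x : 'cV[R]_n | euclid_norm x <= 1]].
Proof.
(* The witness is the Frobenius norm of [M], which works by Cauchy-Schwarz on each row. *)
exists (Num.sqrt (\sum_i dot (row i M)^T (row i M)^T)) => _ [x /= x1 <-].
apply: ler_wsqrtr; apply: ler_sum => i _.
have -> : (M *m x) i 0 = dot (row i M)^T x by rewrite /dot trmxK -row_mul [RHS]mxE.
apply: le_trans (dot_cauchy _ _) _; apply: ler_piMr (dot_ge0 _) _.
by rewrite -sqr_euclid_norm expr_le1 ?euclid_norm_ge0.
Qed.

Lemma op_norm_ge0 (R : realType) p n (M : 'M[R]_(p, n)) : 0 <= op_norm M.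
Proof.
apply: (ub_le_sup (op_norm_has_ubound M)).
by exists 0 => /=; rewrite ?mulmx0 euclid_norm0.
Qed.

Lemma euclid_norm_mulmx (R : realType) p n (M : 'M[R]_(p, n)) x :
  euclid_norm (M *m x) <= op_norm M * euclid_norm x.
Proof.
have [/euclid_norm_eq0 ->|x0] := eqVneq (euclid_norm x) 0.
  by rewrite mulmx0 !euclid_norm0 mulr0.
have xp : 0 < euclid_norm x by rewrite lt_def x0 euclid_norm_ge0.
rewrite -ler_pdivrMr // mulrC.
apply: (ub_le_sup (op_norm_has_ubound M)); exists ((euclid_norm x)^-1 *: x).
  by rewrite /= euclid_normZ ger0_norm ?mulVf // invr_ge0 ltW.
by rewrite -scalemxAr euclid_normZ ger0_norm // invr_ge0 ltW.
Qed.

Lemma dot_mulmx_le (R : realType) n (M : 'M[R]_n) x :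
  dot x (M *m x) <= op_norm M * dot x x.
Proof.
apply: le_trans (ler_norm _) _.
rewrite -(ler_pXn2r (ltn0Sn 1)) ?nnegrE ?normr_ge0 //; last first.
  by rewrite mulr_ge0 ?op_norm_ge0 ?dot_ge0.
rewrite real_normK ?num_real //; apply: le_trans (dot_cauchy _ _) _.
rewrite exprMn [dot x x ^+ 2]expr2 mulrCA ler_wpM2l ?dot_ge0 //.
rewrite -!sqr_euclid_norm -exprMn lerXn2r ?nnegrE ?euclid_norm_ge0 //.
  by rewrite mulr_ge0 ?op_norm_ge0 ?euclid_norm_ge0.
exact: euclid_norm_mulmx.
Qed.

(** Lets quadratic forms replace norms. Symmetry makes the two cross terms of the form at
    [y + r *: x] equal, both being [r ^+ 3]. *)
Lemma op_norm_sym_le (R : realType) n (M : 'M[R]_n) K : M^T = M -> 0 <= K ->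
  (forall x, `|dot x (M *m x)| <= K * dot x x) -> op_norm M <= K.
Proof.
move=> sM K0 HM; apply: ge_sup.
  by exists (euclid_norm (M *m 0)); exists 0 => //=; rewrite euclid_norm0.
move=> _ [x /= x1 <-].
set y := M *m x; set r := euclid_norm y.
have r0 : 0 <= r := euclid_norm_ge0 y.
have [->|rn0] := eqVneq r 0; first by [].
have rp : 0 < r by rewrite lt_def rn0.
have dyy : dot y y = r ^+ 2 by rewrite sqr_euclid_norm.
have dxx : dot x x <= 1 by rewrite -sqr_euclid_norm expr_le1 ?euclid_norm_ge0.
(* polarization at [y, r *: x]: two vectors with norm at most [r] *)
have := HM (y + r *: x); rewrite ler_norml => /andP[_].
have := HM (y + (- r) *: x); rewrite ler_norml => /andP[+ _].
rewrite !mulmxDr -!scalemxAr -/y !dotDl !dotDr !dotZl !dotZr.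
rewrite [dot x (M *m y)]dot_mulmx sM -/y dyy [dot x y]dotC.
move=> h1 h2.
(* In [h2] minus [h1] the terms in [dot y (M *m y)] and [dot y x] cancel, leaving [4 * r ^+ 3 <= 2 *
   K * r ^+ 2 * (1 + dot x x)]. As [dot x x <= 1], this gives the goal multiplied by [r ^+ 2]. *)
rewrite -(ler_pM2r (exprn_gt0 2 rp)).
have : K * r ^+ 2 * dot x x <= K * r ^+ 2.
  by rewrite ler_piMr // mulr_ge0 // exprn_ge0.
nra.
Qed.

Local Close Scope classical_set_scope.

(** Since [S] is symmetric with square [M], the left side is the quadratic form of [M] at [x]. *)
Lemma dot_sqrt_le (R : realType) n (S M : 'M[R]_n) x : is_posdef_sqrt S M ->
  dot (S *m x) (S *m x) <= op_norm M * dot x x.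
Proof.
move=> [[sS _] SM]; rewrite dot_mulmx sS mulmxA SM dotC.
exact: dot_mulmx_le.
Qed.

(* The off-diagonal part of [v v^T] lies between [- diag(v_i^2)] and [v v^T],
   hence between [-1] and [1]. *)
Lemma offdiag_form_le (R : realDomainType) n (v z : 'cV[R]_n) : dot v v <= 1 ->
  `|\sum_i \sum_(j | i != j) (v i 0 * v j 0) * (z i 0 * z j 0)| <= dot z z.
Proof.
move=> v1.
have -> : \sum_i \sum_(j | i != j) (v i 0 * v j 0) * (z i 0 * z j 0) =
    dot v z ^+ 2 - \sum_i (v i 0 * z i 0) ^+ 2.
  rewrite expr2 !dotE big_distrlr -sumrB /=; apply: eq_bigr => i _.
  rewrite [in RHS](bigD1 i) //= expr2 [RHS]addrC addKr.
  by apply: eq_big => [j|j _]; [rewrite eq_sym | ring].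
have lo : \sum_i (v i 0 * z i 0) ^+ 2 <= dot z z.
  rewrite dotE; apply: ler_sum => i _; rewrite exprMn -expr2.
  rewrite ler_piMl ?sqr_ge0 //; apply: le_trans v1.
  rewrite dotE (bigD1 i) //= -expr2 lerDl sumr_ge0 // => j _.
  by rewrite -expr2 sqr_ge0.
have up : dot v z ^+ 2 <= dot z z.
  apply: le_trans (dot_cauchy _ _) _; exact: ler_piMl (dot_ge0 _) _.
have pos : 0 <= \sum_i (v i 0 * z i 0) ^+ 2.
  by apply: sumr_ge0 => i _; apply: sqr_ge0.
have := sqr_ge0 (dot v z); rewrite ler_norml; lra.
Qed.

(* The inverse of row-major vectorization, for which
   [unvec ((B *t A) *m x) = B *m unvec x *m A^T]. *)
Definition unvec (R : pzRingType) n m (x : 'cV[R]_(n * m)) : 'M[R]_(n, m) :=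
  \matrix_(i, k) x (mxtens_index (i, k)) 0.

Lemma sum_mxtens_index (R : nmodType) n m (F : 'I_(n * m) -> R) :
  \sum_p F p = \sum_i \sum_k F (mxtens_index (i, k)).
Proof.
rewrite pair_big /= (reindex (@mxtens_index n m)).
  by apply: eq_bigr => -[].
by exists (@mxtens_unindex n m) => p _; rewrite ?mxtens_indexK ?mxtens_unindexK.
Qed.

Lemma dot_unvec_row (R : pzRingType) n m (x : 'cV[R]_(n * m)) :
  dot x x = \sum_i dot (row i (unvec x))^T (row i (unvec x))^T.
Proof.
rewrite dotE sum_mxtens_index; apply: eq_bigr => i _; rewrite dotE.
by apply: eq_bigr => k _; rewrite !mxE.
Qed.

(** Two readings of the squared Frobenius norm: columns suit multiplication from the left, rows
    multiplication from the right. *)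
Lemma sum_dot_row_col (R : pzRingType) n m (X : 'M[R]_(n, m)) :
  \sum_i dot (row i X)^T (row i X)^T = \sum_k dot (col k X) (col k X).
Proof.
rewrite (eq_bigr (fun i => \sum_k X i k * X i k)) => [|i _].
  rewrite exchange_big; apply: eq_bigr => k _; rewrite dotE.
  by apply: eq_bigr => i _; rewrite !mxE.
by rewrite dotE; apply: eq_bigr => k _; rewrite !mxE.
Qed.

(** The tensor product has rank one: it is [(a *t d) *m (b *t d)^T], and pairing [x] with [a *t d]
    gives [dot a (unvec x *m d)]. *)
Lemma dot_tens_rank1 (R : comPzRingType) n m (a b : 'cV[R]_n) (d : 'cV[R]_m) x :
  dot x (((a *m b^T) *t (d *m d^T)) *m x) =
  dot a (unvec x *m d) * dot b (unvec x *m d).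
Proof.
have E c : dot c (unvec x *m d) =
    \sum_i \sum_k c i 0 * x (mxtens_index (i, k)) 0 * d k 0.
  rewrite dotE; apply: eq_bigr => i _; rewrite mxE mulr_sumr.
  by apply: eq_bigr => k _; rewrite mxE mulrA.
rewrite dotE sum_mxtens_index !E mulr_suml; apply: eq_bigr => i _.
rewrite mulr_suml; apply: eq_bigr => k _; rewrite mxE mulr_sumr.
rewrite sum_mxtens_index mulr_sumr; apply: eq_bigr => j _.
rewrite mulr_sumr; apply: eq_bigr => l _.
by rewrite tensmxE !mxE !big_ord1 !mxE; ring.
Qed.

Lemma dot_A_diamond (R : realType) m n (SA : 'M[R]_m) (SB : 'M[R]_n)
    (U : 'M[bool]_(n, m)) (q : 'cV[R]_n) x :
  let Z := SB^T *m unvec x *m SA in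
  let v k : 'cV[R]_n := \col_i ((U i k)%:R * q i 0) in
  dot x (A_diamond SA SB U q *m x) =
  \sum_k \sum_i \sum_(j | i != j)
    (v k i 0 * v k j 0) * (col k Z i 0 * col k Z j 0).
Proof.
move=> Z v; rewrite /dot /A_diamond mulmx_suml mulmx_sumr summxE.
apply: eq_bigr => k _; rewrite mulmx_suml mulmx_sumr summxE.
apply: eq_bigr => i _; rewrite mulmx_suml mulmx_sumr summxE.
apply: eq_bigr => j _.
rewrite -scalemxAl -scalemxAr mxE -/(dot _ _) dot_tens_rank1.
(* Each factor of the rank-one form is a single entry of [Z]; the mask and [q] go into [v k]. *)
have E l : dot (col l SB) (unvec x *m col k SA) = col k Z l 0.
  by rewrite /dot tr_col -row_mul mulmxA [in LHS]colE mulmxA -colE [LHS]mxE.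
by rewrite !E ![v k _ _]mxE; ring.
Qed.

(** Transposing a summand exchanges [i] and [j] in its tensor factor, while its coefficient and the
    condition [i != j] are symmetric in them. *)
Lemma A_diamond_sym (R : realType) m n (SA : 'M[R]_m) (SB : 'M[R]_n)
    (U : 'M[bool]_(n, m)) (q : 'cV[R]_n) :
  (A_diamond SA SB U q)^T = A_diamond SA SB U q.
Proof.
rewrite /A_diamond linear_sum; apply: eq_bigr => k _ /=.
rewrite linear_sum /=.
transitivity (\sum_(i < n) \sum_(j < n | i != j)
    (((U i k)%:R * (U j k)%:R * (q i 0 * q j 0)) *:
      ((col j SB *m (col i SB)^T) *t (col k SA *m (col k SA)^T)))^T).
  by apply: eq_bigr => i _; rewrite linear_sum.
rewrite (exchange_big_dep xpredT) //=; apply: eq_bigr => i _.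
apply: eq_big => [j|j _]; first by rewrite eq_sym.
by rewrite linearZ /= trmx_tens !trmx_mul !trmxK; congr (_ *: _); ring.
Qed.

Theorem theorem4p3 (R : realType) (m n : nat)
    (A0 : 'M[R]_m) (B0 : 'M[R]_n)
    (hA0 : sym_posdef A0) (hB0 : sym_posdef B0) (htrB0 : \tr B0 = n%:R)
    (SA : 'M[R]_m) (SB : 'M[R]_n)
    (hSA : is_posdef_sqrt SA A0) (hSB : is_posdef_sqrt SB B0)
    (U : 'M[bool]_(n, m)) (q : 'cV[R]_n) (hq : euclid_norm q = 1) :
  op_norm (A_diamond SA SB U q) <= op_norm A0 * op_norm B0.
Proof.
apply: op_norm_sym_le => [||x]; first exact: A_diamond_sym.
  by rewrite mulr_ge0 ?op_norm_ge0.
have [[sSA _] _] := hSA; have [[sSB _] _] := hSB.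
rewrite dot_A_diamond; set Z := _ *m SA.
apply: le_trans (ler_norm_sum _ _ _) _.
apply: (@le_trans _ _ (\sum_k dot (col k Z) (col k Z))).
  apply: ler_sum => k _; apply: offdiag_form_le.
  apply: (@le_trans _ _ (dot q q)); last by rewrite -sqr_euclid_norm hq expr1n.
  (* Masking keeps an entry of [q] or replaces it by zero, so it cannot increase the norm. *)
  rewrite !dotE; apply: ler_sum => i _; rewrite mxE -!expr2 exprMn.
  by apply: ler_piMl; [exact: sqr_ge0 | case: (U i k); rewrite ?expr1n ?expr0n].
(* [SB] acts on each column separately, so it is removed column by column at the cost of
   [op_norm B0]. *)
have -> : Z = SB *m (unvec x *m SA) by rewrite /Z sSB mulmxA.
apply: (@le_trans _ _ (op_norm B0 *
    \sum_k dot (col k (unvec x *m SA)) (col k (unvec x *m SA)))).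
  rewrite mulr_sumr; apply: ler_sum => k _; rewrite !colE -mulmxA -colE.
  exact: dot_sqrt_le.
rewrite [op_norm A0 * _]mulrC -mulrA ler_wpM2l ?op_norm_ge0 //.
(* [SA] multiplies from the right, so the sum is turned to rows, where its transpose acts on each
   row at the cost of [op_norm A0]. *)
rewrite -sum_dot_row_col dot_unvec_row mulr_sumr; apply: ler_sum => i _.
rewrite row_mul trmx_mul sSA; exact: dot_sqrt_le.
Qed.
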